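(* Let $d\ge 1$ and let $\Gamma$ be a graph with at least $d+1$ vertices. If $\Gamma$ is $(d+1)$-vertex-connected, then $\Gamma$ is generically neighborhood affinely rigid in $\mathbb{R}^d$; that is, for every generic configuration $p:V(\Gamma)\to\mathbb{R}^d$, the framework $(p,N(\Gamma))$ of the neighborhood hypergraph of $\Gamma$ is affinely rigid in $\mathbb{R}^d$.
   Context: A hypergraph $\Theta$ consists of a finite vertex set $V$ and a set $E$ of hyperedges, each a subset of $V$. A configuration in $\mathbb{R}^d$ is a map $p:V\to\mathbb{R}^d$; a framework is a pair $(p,\Theta)$. Two frameworks $(p,\Theta),(q,\Theta)$ in $\mathbb{R}^d$ are affinely equivalent if for every hyperedge $h$ there is an invertible affine map $g_h$ of $\mathbb{R}^d$ with $g_h(p(u))=q(u)$ for all $u\in h$; they are affinely congruent if a single invertible affine map $g$ of $\mathbb{R}^d$ satisfies $g(p(u))=q(u)$ for all $u\in V$. The framework $(p,\Theta)$ is affinely rigid in $\mathbb{R}^d$ if every framework $(q,\Theta)$ in $\mathbb{R}^d$ affinely equivalent to it is affinely congruent to it. The neighborhood hypergraph $N(\Gamma)$ of a graph $\Gamma$ has the same vertices as $\Gamma$ and, for each vertex $u$, one hyperedge consisting of $u$ together with all its neighbors in $\Gamma$. A configuration is generic if its coordinates satisfy no nonzero polynomial equation with rational coefficients. *)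

(* Defs.v *)
From HB Require Import structures.
From mathcomp Require Import all_boot all_order all_algebra.
From mathcomp Require Import reals.
From mathcomp Require Import mpoly.
Set Implicit Arguments. Unset Strict Implicit. Unset Printing Implicit Defensive.
Import Order.TTheory GRing.Theory Num.Theory.
Local Open Scope ring_scope.

Definition simple_graph (V : finType) (e : rel V) : Prop :=
  ssrbool.symmetric e /\ ssrbool.irreflexive e.

Definition connected_without (V : finType) (e : rel V) (S : {set V}) : Prop :=
  forall x y : V, x \notin S -> y \notin S ->
    connect [rel a b | [&& e a b, a \notin S & b \notin S]] x y.

(* k-vertex-connected: deleting fewer than k vertices leaves a connected graph.
   (The vertex-count requirement is stated separately in the theorem.) *)
Definition k_vertex_connected (V : finType) (e : rel V) (k : nat) : Prop :=
  forall S : {set V}, (#|S| < k)%N -> connected_without e S.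

Definition nbhd_hypergraph (V : finType) (e : rel V) : {set {set V}} :=
  [set (u |: [set v | e u v]) | u : V].

Definition aff_equivalent (R : realType) (d : nat) (V : finType)
    (E : {set {set V}}) (p q : V -> 'rV[R]_d) : Prop :=
  forall h, h \in E -> exists (A : 'M[R]_d) (b : 'rV[R]_d),
    A \in unitmx /\ forall u, u \in h -> q u = p u *m A + b.

Definition aff_congruent (R : realType) (d : nat) (V : finType)
    (p q : V -> 'rV[R]_d) : Prop :=
  exists (A : 'M[R]_d) (b : 'rV[R]_d),
    A \in unitmx /\ forall u, q u = p u *m A + b.

Definition aff_rigid (R : realType) (d : nat) (V : finType)
    (E : {set {set V}}) (p : V -> 'rV[R]_d) : Prop :=
  forall q : V -> 'rV[R]_d, aff_equivalent E p q -> aff_congruent p q.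

Definition coords (R : realType) (d : nat) (V : finType) (p : V -> 'rV[R]_d)
    : 'I_(#|V| * d) -> R :=
  fun i => mxvec (\matrix_(k < #|V|, j < d) p (enum_val k) 0 j) 0 i.

Definition generic (R : realType) (d : nat) (V : finType) (p : V -> 'rV[R]_d)
    : Prop :=
  forall P : mpoly.mpoly (#|V| * d) rat, P != 0 ->
    mpoly.meval (coords p) (mpoly.map_mpoly (ratr : rat -> R) P) != 0.

(* Main.v *)
Require Import Defs.
From HB Require Import structures.
From mathcomp Require Import all_boot all_order all_fingroup all_algebra.
From mathcomp Require Import reals.
From mathcomp Require Import mpoly zify.
Set Implicit Arguments. Unset Strict Implicit. Unset Printing Implicit Defensive.
Import Order.TTheory GRing.Theory Num.Theory.

(* Put n = #|V| and k = d + 1.  A configuration q equivalent to p amounts to one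
   affine map per vertex such that the maps at u and at v agree at the point p v
   whenever v lies in the closed neighborhood of u; the claim is that all these
   maps coincide.  This says that a matrix polynomial in the coordinates of p has
   full rank, so it suffices to find one rational configuration for which it holds.

   Choose k vertices X.  Connectivity gives Hall's condition for matching, for
   every N with #|N| >= k, the vertices of X into N and each other vertex u into
   its closed neighborhood.  Hence a generic matrix M whose column u (for u not
   in X) is supported on the closed neighborhood of u has a k-dimensional left
   kernel, on which restriction to any such N is injective.  Take a basis of this
   kernel as homogeneous coordinates of the vertices.  If linear forms a_u agree
   as above, then f v = a_v (P v) = a_u (P v) for v near u, so f is killed by M,
   hence f = c P for one form c, and a_u = c because a_u P = c P on at least k
   vertices. *)

(** * Hall's marriage theorem *)

Lemma hall_marriage (I T : finType) (r : I -> {set T}) :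
    (forall A : {set I}, #|A| <= #|\bigcup_(i in A) r i|) ->
  exists2 s : I -> T, injective s & forall i, s i \in r i.
Proof.
(* Rado's argument: if some r i has two elements, one of them can be dropped. *)
have [m] := ubnP (\sum_i #|r i|); elim: m r => // m IHm r le_m hallr.
have r_gt0 i : 0 < #|r i|.
  by have := hallr [set i]; rewrite cards1 big_set1.
have [/existsP[i /card_gt1P[x [y [rx ry neq_xy]]]]|/existsPn r_le1] :=
  boolP [exists i, 1 < #|r i|]; last first.
  have /fin_all_exists[s sP] i : exists x, r i = [set x].
    by apply/cards1P; rewrite eqn_leq r_gt0 leqNgt r_le1.
  exists s => [i j eq_s|i]; last by rewrite sP set11.
  apply/eqP; apply: contraT => neq_ij.
  have := hallr [set i; j].
  by rewrite cards2 neq_ij bigcup_setU !big_set1 !sP eq_s setUid cards1.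
pose r' z j := if j == i then r i :\ z else r j.
pose hall z := [forall A : {set I}, #|A| <= #|\bigcup_(j in A) r' z j|].
have r'_sub z j : r' z j \subset r j.
  by rewrite /r'; case: eqP => [->|]; rewrite ?subD1set.
have descend z : z \in r i -> hall z ->
    exists2 s : I -> T, injective s & forall i, s i \in r i.
  move=> rz /forallP hallz.
  have [||s s_inj sP] := IHm (r' z) => //; last first.
    by exists s => // j; apply: (subsetP (r'_sub z j)).
  rewrite (leq_trans _ (ltnSE le_m))// (bigD1 i)//= [ltnRHS](bigD1 i)//=.
  rewrite /r' eqxx (cardsD1 z (r i)) rz add1n addSn ltnS leq_add2l.
  by apply: leq_sum => j /negPf ->.
have [/(descend x rx)//|/forallPn[A]] := boolP (hall x); rewrite -ltnNge => badA.
have [/(descend y ry)//|/forallPn[B]] := boolP (hall y); rewrite -ltnNge => badB.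
exfalso.
have mem_bad z (D : {set I}) : #|\bigcup_(j in D) r' z j| < #|D| -> i \in D.
  apply: contraTT => iD; rewrite -leqNgt (leq_trans (hallr D))//.
  rewrite (eq_bigr (r' z))// => j jD; rewrite /r'; case: eqP => // eji.
  by rewrite eji (negPf iD) in jD.
have iA := mem_bad _ _ badA; have iB := mem_bad _ _ badB.
set RA := \bigcup_(j in A) _ in badA; set RB := \bigcup_(j in B) _ in badB.
(* Submodularity: [RA :|: RB] regains all of [r i] since [x != y], and Hall's condition for
   [A :|: B] and [(A :&: B) :\ i] forces [#|A| + #|B| - 1 <= #|RA| + #|RB|], but two strict deficits
   cost 2. *)
have leU : #|A :|: B| <= #|RA :|: RB|.
  apply: leq_trans (hallr _) (subset_leq_card _); apply/bigcupsP => j jAB.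
  have [->|neq_ji] := eqVneq j i.
    apply/subsetP => z rz; rewrite inE; apply/orP.
    have [eq_zx|neq_zx] := eqVneq z x; [right|left]; apply/bigcupP; exists i => //.
      by rewrite /r' eqxx !inE rz eq_zx neq_xy.
    by rewrite /r' eqxx !inE rz neq_zx.
  have r'E z : r' z j = r j by rewrite /r' (negPf neq_ji).
  case/setUP: jAB => jD.
    by apply: subset_trans (subsetUl _ _); rewrite -(r'E x) bigcup_sup.
  by apply: subset_trans (subsetUr _ _); rewrite -(r'E y) bigcup_sup.
have leI : #|(A :&: B) :\ i| <= #|RA :&: RB|.
  apply: leq_trans (hallr _) (subset_leq_card _); apply/bigcupsP => j.
  rewrite !inE => /and3P[neq_ji jA jB].
  have r'E z : r' z j = r j by rewrite /r' (negPf neq_ji).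
  by rewrite subsetI -{1}(r'E x) -(r'E y) !bigcup_sup.
have := cardsUI A B; have := cardsUI RA RB.
by have := cardsD1 i (A :&: B); rewrite !inE iA iB /=; lia.
Qed.

(** * Linking permutations from expansion *)

Section Matching.
Variables (n k : nat) (E : 'I_n -> {set 'I_n}).

(** The form in which connectivity is used; the first alternative covers sets too large to gain [k]
    elements. *)
Definition expanding := forall A : {set 'I_n}, A != set0 ->
  \bigcup_(i in A) E i = setT \/ #|A| + k <= #|\bigcup_(i in A) E i|.

Hypothesis E_expanding : expanding.

Lemma expanding_card i : k <= n -> k <= #|E i|.
Proof.
move=> le_kn; have [||] := E_expanding (A := [set i]).
- by apply/set0Pn; exists i; rewrite set11.
- by rewrite big_set1 => ->; rewrite cardsT card_ord.
- by rewrite big_set1; apply: leq_trans; rewrite leq_addl.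
Qed.

(** The indices below [k] play the role of [X]. In Hall's condition, the surplus [k] of [A :\: X]
    pays for the at most [k] elements of [A] in [X]; if [A :\: X] is empty, [N] alone is large
    enough. *)
Lemma exists_linking_perm (N : {set 'I_n}) : k <= #|N| ->
  exists s : {perm 'I_n}, forall i : 'I_n, s i \in if i < k then N else E i.
Proof.
move=> le_kN; have le_kn : k <= n by rewrite -[n]card_ord (leq_trans le_kN)// max_card.
pose X := [set i : 'I_n | i < k].
have cardX : #|X| = k.
  have -> : X = widen_ord le_kn @: setT.
    apply/setP => i; rewrite inE;
    apply/idP/imsetP => [lt_ik|[j _ ->]]; last exact: (ltn_ord j).
    by exists (Ordinal lt_ik); rewrite ?inE//; apply: val_inj.
  by rewrite card_imset ?cardsT ?card_ord// => i j /(congr1 val) /= /val_inj.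
have [A|s s_inj sP] := hall_marriage (r := fun i : 'I_n => if i < k then N else E i).
  set R := \bigcup_(i in A) _.
  have subR (D : {set 'I_n}) : D \subset A -> [disjoint D & X] ->
      \bigcup_(i in D) E i \subset R.
    move=> /subsetP DA dis; apply/bigcupsP => i iD.
    have /negPf ik : ~~ (i < k).
      by have /negP := disjointFr dis iD; rewrite inE => /negP.
    by rewrite /R (bigcup_max i)// ?DA// ik.
  have leAX : #|A| <= #|A :\: X| + k.
    by rewrite -(cardsID X A) addnC leq_add2l -cardX subset_leq_card ?subsetIr.
  have disAX : [disjoint A :\: X & X] by rewrite -setI_eq0 setIDAC setDIl setDv setI0.
  have [AX0|/E_expanding[AXT|leAXk]] := eqVneq (A :\: X) set0.
  - have [->|/set0Pn[i iA]] := eqVneq A set0; first by rewrite cards0.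
    have iX : i \in X by apply: contraT => iX; rewrite -(in_set0 i) -AX0 inE iX.
    have leNR : #|N| <= #|R|.
      by apply/subset_leq_card; apply: (bigcup_max i) => //; rewrite inE in iX; rewrite iX.
    by apply: leq_trans leNR; apply: leq_trans le_kN; rewrite AX0 cards0 in leAX.
  - have /subset_leq_card : setT \subset R by rewrite -AXT subR ?subsetDl.
    by rewrite cardsT; apply: leq_trans; apply: max_card.
  - rewrite (leq_trans leAX)// (leq_trans leAXk)// subset_leq_card//.
    by rewrite subR ?subsetDl.
by exists (perm s_inj) => i; rewrite permE.
Qed.

End Matching.

(** * Connectivity makes closed neighborhoods expand *)

Section ClosedNeighborhoods.
Variables (V : finType) (e : rel V).

Definition cnbhd (i : 'I_#|V|) : {set 'I_#|V|} :=
  [set j | (j == i) || e (enum_val i) (enum_val j)].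

Lemma cnbhd_refl i : i \in cnbhd i.
Proof. by rewrite inE eqxx. Qed.

(** Otherwise [B :\: A] has fewer than [k] elements, and deleting it separates [A] from the
    complement of [B]: a path leaving [A] must enter [B :\: A]. *)
Lemma cnbhd_expanding k : k_vertex_connected e k -> expanding k cnbhd.
Proof.
move=> conn A /set0Pn[a aA]; set B := \bigcup_(i in A) _.
have AB : A \subset B.
  by apply/subsetP => i iA; apply/bigcupP; exists i; rewrite ?cnbhd_refl.
have [BT|neqBT] := eqVneq B setT; [by left | right].
rewrite leqNgt; apply/negP => ltB.
have [b bB] : exists b, b \notin B.
  apply/existsP; rewrite -negb_forall; apply: contra neqBT => /forallP BT.
  by apply/eqP/setP=> i; rewrite BT inE.
pose S := [set enum_val i | i in B :\: A].
have memS i : (enum_val i \in S) = (i \in B :\: A).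
  by apply: mem_imset; apply: enum_val_inj.
have ltS : #|S| < k.
  rewrite card_imset; last exact: enum_val_inj.
  by rewrite cardsD (setIidPr AB) ltn_subLR ?subset_leq_card.
have := conn S ltS (enum_val a) (enum_val b).
rewrite !memS !inE aA (negPf bB) andbF => /(_ isT isT).
case/connectP => p.
have : enum_rank (enum_val a) \in A by rewrite enum_valK.
elim: p (enum_val a) => [|y p IHp] x xA /=.
  by move=> _ eq_xb; rewrite -eq_xb enum_valK in xA; rewrite (subsetP AB) in bB.
case/andP=> /and3P[exy _ yS]; apply: IHp.
apply: contraR yS => yA; rewrite -[y]enum_rankK memS inE yA /=.
by apply/bigcupP; exists (enum_rank x) => //; rewrite inE !enum_rankK exy orbT.
Qed.

End ClosedNeighborhoods.

Local Open Scope ring_scope.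

(** * Keeping finitely many determinants nonzero at once *)

Lemma poly_nonroot (F : numDomainType) (p : {poly F}) :
  p != 0 -> exists t, p.[t] != 0.
Proof.
move=> p_neq0; pose rs : seq F := [seq i%:R | i <- iota 0 (size p)].
have [/(max_poly_roots p_neq0)|/allPn[t _ pt]] := boolP (all (root p) rs).
  rewrite size_map size_iota ltnn map_inj_uniq ?iota_uniq => [/(_ isT)//|].
  by move=> i j /eqP; rewrite eqr_nat => /eqP.
by exists t.
Qed.

(* Two matrices good for different indices are joined by a line, on which each
   determinant is a nonzero polynomial in the parameter. *)
Lemma det_avoid (F : numFieldType) n (I : eqType) (s : seq I) (C : I -> 'M[F]_n)
    (S : 'M[F]_n -> Prop) :
    S 0 -> (forall t A B, S A -> S B -> S (A + t *: B)) ->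
    (forall i, i \in s -> exists2 M, S M & \det (C i + M) != 0) ->
  exists2 M, S M & forall i, i \in s -> \det (C i + M) != 0.
Proof.
move=> S0 S_lin; elim: s => [_|i s IHs goodS]; first by exists 0.
have [j js|M1 SM1 goodM1] := IHs; first by apply: goodS; rewrite inE js orbT.
have [|M2 SM2 goodM2] := goodS i; first by rewrite mem_head.
pose B := M2 + (-1) *: M1.
pose D j := \det (map_mx polyC (C j + M1) + 'X *: map_mx polyC B).
have DE j t : (D j).[t] = \det (C j + (M1 + t *: B)).
  rewrite -horner_evalE -det_map_mx; congr (\det _); apply/matrixP => a b.
  by rewrite !mxE /= horner_evalE !hornerE ?addrA.
have [t] : exists t, (\prod_(j <- i :: s) D j).[t] != 0.
  apply: poly_nonroot; rewrite prodf_seq_neq0; apply/allP => j.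
  rewrite inE /= => /predU1P[->|js].
    apply: contraNneq goodM2 => D0; move: (DE i 1).
    by rewrite D0 horner0 scale1r [M1 + _]addrC /B scaleN1r subrK => <-.
  apply: contraNneq (goodM1 j js) => D0; move: (DE j 0).
  by rewrite D0 horner0 scale0r addr0 => <-.
rewrite horner_prod prodf_seq_neq0 => /allP goodt.
exists (M1 + t *: B) => [|j js]; last by rewrite -DE; apply: goodt.
by apply: (S_lin) => //; apply: (S_lin).
Qed.

(** * A rigid system of points in homogeneous coordinates *)

Section RigidPoints.
Variables (F : numFieldType) (n : nat) (E : 'I_n -> {set 'I_n}).

(* The columns of P are points in homogeneous coordinates, the rows of a are
   linear forms: the form at u and the form at v agree at the point v. *)
Definition locally_affine k (P : 'M[F]_(k, n)) (a : 'M[F]_(n, k)) :=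
  forall u v, v \in E u -> (a *m P) u v = (a *m P) v v.

Definition affinely_rigid k (P : 'M[F]_(k, n)) :=
  forall a : 'M_(n, k), locally_affine P a -> forall u v, row u a = row v a.

(** Multiplying a row [f] by it reads off [f] at the points [s u] with [u < k]. It fills exactly the
    columns that a [supported] matrix leaves zero. *)
Definition selector (k : nat) (s : {perm 'I_n}) : 'M[F]_n :=
  \matrix_(v, u) ((u < k)%N && (v == s u))%:R.

Definition supported (k : nat) (M : 'M[F]_n) :=
  forall v u : 'I_n, ~~ ((k <= u)%N && (v \in E u)) -> M v u = 0.

Lemma mul_selectorE k s (f : 'rV[F]_n) u :
  (f *m selector k s) 0 u = if (u < k)%N then f 0 (s u) else 0.
Proof.
rewrite mxE (bigD1 (s u))//= big1 ?addr0 => [|v /negPf vu].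
  by rewrite mxE eqxx andbT; case: ifP; rewrite ?mulr1 ?mulr0.
by rewrite mxE vu andbF mulr0.
Qed.

Lemma mul_supportedE k M (f : 'rV[F]_n) (u : 'I_n) :
  supported k M -> (u < k)%N -> (f *m M) 0 u = 0.
Proof.
by move=> supM lt_uk; rewrite mxE big1// => v _; rewrite supM ?mulr0// leqNgt lt_uk.
Qed.

(** For a single [s], the remaining columns of its permutation matrix will do; [det_avoid] then
    gives one [M] for all [s]. *)
Lemma exists_generic_support k : exists2 M : 'M[F]_n, supported k M &
  forall s : {perm 'I_n}, (forall u : 'I_n, (k <= u)%N -> s u \in E u) ->
    \det (selector k s + M) != 0.
Proof.
pose adm := [pred s : {perm 'I_n} | [forall u : 'I_n, (k <= u)%N ==> (s u \in E u)]].
have [|t A B supA supB v u vu|s|M supM goodM] :=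
  @det_avoid F n _ [seq s <- enum {: {perm 'I_n}} | adm s] (selector k) (supported k).
- by move=> v u _; rewrite mxE.
- by rewrite !mxE supA ?supB ?mulr0 ?addr0.
- rewrite mem_filter => /andP[/forallP admS _].
  exists (\matrix_(v, u) ((k <= u)%N && (v == s u))%:R) => [v u|].
    rewrite mxE; case: (leqP k u) => //= le_ku; case: eqP => // ->.
    by have := admS u; rewrite le_ku /= => ->.
  rewrite (_ : _ + _ = (perm_mx s)^T) ?det_tr ?det_perm ?signr_eq0//.
  apply/matrixP => v u; rewrite !mxE [s u == v]eq_sym.
  by case: (leqP k u); rewrite ?addr0 ?add0r.
- exists M => // s admS; apply: goodM; rewrite mem_filter mem_enum andbT.
  by apply/forallP => u; apply/implyP/admS.
Qed.

Lemma exists_homogeneous_rigid k : (0 < k <= n)%N -> expanding k E ->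
  exists P : 'M[F]_(k, n), affinely_rigid P /\ forall v, exists j, P j v != 0.
Proof.
move=> /andP[k_gt0 le_kn] exE; have [M supM goodM] := exists_generic_support k.
have linking (N : {set 'I_n}) : (k <= #|N|)%N -> exists s : {perm 'I_n},
    [/\ forall u : 'I_n, (u < k)%N -> s u \in N,
        forall u : 'I_n, (k <= u)%N -> s u \in E u
      & selector k s + M \in unitmx].
  move=> /(exists_linking_perm exE)[s sP]; exists s.
  have sE (u : 'I_n) : (k <= u)%N -> s u \in E u.
    by have := sP u; case: ltnP.
  split=> // [u lt_uk|]; first by have := sP u; rewrite lt_uk.
  by rewrite unitmxE unitfE goodM.
(* Restriction to [N] is injective on the left kernel of [M]: if [f] vanishes on [N], the invertible
   [selector k s + M] kills it. *)
have ker0 (N : {set 'I_n}) (f : 'rV_n) : (k <= #|N|)%N ->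
    (forall v, v \in N -> f 0 v = 0) -> f *m M = 0 -> f = 0.
  move=> /linking[s [sN _ sU]] fN fM; rewrite -(mulmxK sU f) mulmxDr fM addr0.
  rewrite (_ : f *m _ = 0) ?mul0mx//; apply/rowP => u.
  by rewrite mul_selectorE mxE; case: ltnP => // /sN/fN.
pose w : 'I_k -> 'I_n := widen_ord le_kn.
have w_inj : injective w by move=> i j /(congr1 val) /= /val_inj.
pose X := [set w j | j in 'I_k].
have cardX : #|X| = k by rewrite card_imset ?card_ord.
have memX (u : 'I_n) : (u < k)%N -> exists j, u = w j.
  by move=> lt_uk; exists (Ordinal lt_uk); apply: val_inj.
(* [E] is not assumed reflexive, so [goodM] need not apply to the identity; invertibility comes from
   [ker0] with [N = X]. *)
pose T := selector k 1 + M.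
have TU : T \in unitmx.
  rewrite unitmxE unitfE; apply/det0P => -[f /eqP f_neq0 fT]; apply: f_neq0.
  have fTE u : (f *m selector k 1) 0 u + (f *m M) 0 u = 0.
    by have /rowP/(_ u) := fT; rewrite mulmxDr mxE [RHS]mxE.
  apply: (ker0 X) => [|_ /imsetP[j _ ->]|].
    by rewrite cardX.
    have := fTE (w j); rewrite mul_selectorE (mul_supportedE _ supM) ?addr0 //=.
    by rewrite ltn_ord perm1.
  apply/rowP => u; rewrite [RHS]mxE; case: (ltnP u k) => [|le_ku].
    exact: mul_supportedE.
  by have := fTE u; rewrite mul_selectorE ltnNge le_ku add0r.
(* The rows of [P] are the basis of the left kernel of [M] dual to the coordinates in [X]. *)
pose P := rowsub w (invmx T); exists P.
have kerP (f : 'rV_n) : f *m M = 0 -> f = colsub w f *m P.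
  move=> fM; rewrite -{1}(mulmxK TU f) mulmxDr fM addr0.
  apply/rowP => v; rewrite mxE [RHS]mxE (bigID (mem X)) /= addrC big1 ?add0r.
    rewrite big_imset /=; last by move=> i j _ _ /w_inj.
    by apply: eq_bigr => j _; rewrite mul_selectorE !mxE /= ltn_ord perm1.
  move=> u uX; rewrite mul_selectorE; case: ltnP => [/memX[j uj]|_].
    by rewrite uj imset_f in uX.
  by rewrite mul0r.
have rowPT j : row j P *m T = delta_mx 0 (w j).
  by rewrite row_rowsub -row_mul mulVmx// row1.
have PM : P *m M = 0.
  apply/row_matrixP => j; rewrite row0 row_mul; apply/rowP => u; rewrite [RHS]mxE.
  case: (ltnP u k) => [|le_ku]; first exact: mul_supportedE.
  have /rowP/(_ u) := rowPT j.
  rewrite mulmxDr mxE mul_selectorE ltnNge le_ku add0r => ->.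
  rewrite mxE eqxx; case: eqP => // uj.
  by have := ltn_ord j; rewrite ltnNge -[val j]/(val (w j)) -uj le_ku.
have PK (c : 'rV_k) : c *m P = 0 -> c = 0.
  move=> cP; rewrite -[c]mulmx1; have <- : P *m colsub w T = 1%:M.
    rewrite mulmx_colsub mul_rowsub_mx mulVmx//.
    by apply/matrixP => i j; rewrite !mxE (inj_eq w_inj).
  by rewrite mulmxA cP mul0mx.
split=> [a aP u v|v].
  pose f : 'rV_n := \row_v (a *m P) v v.
  (* Column [i] of [M] only sees [E i], where [f] agrees with [row i a *m P], and [P *m M = 0]. *)
  have [c fc] : exists c : 'rV_k, f = c *m P.
    exists (colsub w f); apply: kerP; apply/rowP => i; rewrite [RHS]mxE.
    transitivity ((row i a *m (P *m M)) 0 i); last by rewrite PM mulmx0 mxE.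
    rewrite mulmxA -row_mul !mxE; apply: eq_bigr => x _; rewrite !mxE.
    have [/andP[_ xi]|/supM ->] := boolP ((k <= i)%N && (x \in E i));
      last by rewrite !mulr0.
    by have := aP _ _ xi; rewrite !mxE => ->.
  suff rowa i : row i a = c by rewrite !rowa.
  apply/eqP; rewrite -subr_eq0; apply/eqP/PK/(ker0 (E i)).
  - exact: expanding_card.
  - move=> x xi; rewrite mulmxBl -fc -row_mul !mxE; have := aP _ _ xi.
    by rewrite !mxE => ->; rewrite subrr.
  - by rewrite -mulmxA PM mulmx0.
(* No column of [P] is zero: a linking of [X] onto a [k]-set [N] containing [v] yields a kernel
   vector [g] with value 1 at [v], and [g] is a combination of the rows of [P]. *)
pose w0 := w (Ordinal k_gt0).
pose N := tperm w0 v @: X.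
have cardN : #|N| = k by rewrite card_imset ?cardX//; apply: perm_inj.
have [|s [sN _ sU]] := linking N; first by rewrite cardN.
have sXN : s @: X = N.
  apply/eqP; rewrite eqEcard cardN card_imset ?cardX ?leqnn ?andbT; last exact: perm_inj.
  by apply/subsetP => _ /imsetP[_ /imsetP[j _ ->] ->]; apply: sN; apply: (ltn_ord j).
have /imsetP[_ /imsetP[j _ ->] vj] : v \in s @: X.
  by rewrite sXN -[X in X \in N](tpermL w0 v) imset_f// imset_f.
pose g : 'rV_n := delta_mx 0 (w j) *m invmx (selector k s + M).
have gE : g *m selector k s + g *m M = delta_mx 0 (w j) by rewrite -mulmxDr mulmxKV.
have gM : g *m M = 0.
  apply/rowP => u; rewrite [RHS]mxE; case: (ltnP u k) => [|le_ku].
    exact: mul_supportedE.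
  have /rowP/(_ u) := gE; rewrite mxE mul_selectorE ltnNge le_ku add0r => ->.
  rewrite mxE eqxx; case: eqP => // uj.
  by have := ltn_ord j; rewrite ltnNge -[val j]/(val (w j)) -uj le_ku.
have gv : g 0 v = 1.
  have /rowP/(_ (w j)) := gE; rewrite mxE mul_selectorE gM !mxE !eqxx addr0 -vj.
  by rewrite /= ltn_ord.
apply/existsP; apply: contraT => /existsPn Pv0.
have := oner_neq0 F; rewrite -gv (kerP g gM) mxE big1 ?eqxx// => i _.
by have := Pv0 i; rewrite negbK => /eqP ->; rewrite mulr0.
Qed.

End RigidPoints.

(* A linear form b vanishing at no column of P is moved to infinity: dividing
   each column by its value under b leaves the affine chart b = 1. *)
Lemma exists_affine_rigid (F : numFieldType) n (E : 'I_n -> {set 'I_n}) d :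
    (d < n)%N -> expanding d.+1 E ->
  exists p : 'M[F]_(d, n),
    affinely_rigid E (col_mx (const_mx 1) p : 'M_(1 + d, n)).
Proof.
move=> lt_dn exE.
have [P [rigP P_neq0]] : exists P : 'M[F]_(1 + d, n),
    affinely_rigid E P /\ forall v, exists j, P j v != 0.
  exact: exists_homogeneous_rigid.
(* The value at column [v] of the form [(1, t, ..., t^d)], as a polynomial in [t]; some [t] is a
   root of none of them. *)
pose D v : {poly F} := \poly_(j < d.+1) P (inord j) v.
have [t] : exists t, (\prod_v D v).[t] != 0.
  apply: poly_nonroot; apply/prodf_neq0 => v _; have [j Pjv] := P_neq0 v.
  apply: contraNneq Pjv => D0; have := coef_poly d.+1 (fun j => P (inord j) v) j.
  by rewrite -/(D v) D0 coef0 ltn_ord inord_val => <-.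
rewrite horner_prod => /prodf_neq0 Dt.
pose b : 'rV[F]_(1 + d) := \row_j t ^+ j.
pose z v := (b *m P) 0 v.
have zE v : z v = (D v).[t].
  rewrite /z mxE horner_poly; apply: eq_bigr => j _.
  by rewrite mxE inord_val mulrC.
pose p : 'M[F]_(d, n) := \matrix_(j, v) (P (rshift 1 j) v / z v); exists p => a aP.
(* The forms [a] pulled back to the old coordinates, with [b] substituted for the first one. As [b]
   has first entry 1, [a'] determines [a]. *)
pose a' : 'M_(n, 1 + d) := lsubmx a *m b + row_mx 0 (rsubmx a).
have a'P u v : (a' *m P) u v = (a *m col_mx (const_mx 1) p) u v * z v.
  have zv : z v != 0 by rewrite zE Dt.
  rewrite -[a in RHS]hsubmxK mul_row_col mulmxDl -mulmxA -[P in row_mx _ _ *m P]vsubmxK.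
  rewrite mul_row_col mul0mx add0r mxE [in RHS]mxE mulrDl; congr (_ + _).
    by rewrite mxE [X in _ = X * _]mxE !big_ord1 [const_mx _ _ _]mxE mulr1.
  rewrite !mxE mulr_suml; apply: eq_bigr => j _; rewrite !mxE -mulrA divfK//.
have rig_a' : forall u v, row u a' = row v a'.
  by apply: rigP => u v uv; rewrite !a'P aP.
have a'0 u : a' u (lshift d 0) = a u (lshift d 0).
  by rewrite mxE row_mxEl [X in X + _]mxE big_ord1 !mxE /= addr0 expr0 mulr1.
have la u v : a u (lshift d 0) = a v (lshift d 0).
  by have /rowP/(_ (lshift d 0)) := rig_a' u v; rewrite ![row _ _ _ _]mxE !a'0.
move=> u v; apply/rowP => j; rewrite !mxE.
have [i ->|i ->] := split_ordP j; first by rewrite ord1; apply: la.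
have /rowP/(_ (rshift 1 i)) := rig_a' u v.
rewrite ![row _ _ _ _]mxE ![a' _ _]mxE !row_mxEr !mxE !big_ord1 !mxE.
by rewrite ord1 (la u v) => /addrI.
Qed.

(** * From one rational configuration to all generic ones *)

Section Transfer.
Variables (n k : nat) (E : 'I_n -> {set 'I_n}) (u0 : 'I_n).

Section Discrepancy.
Variables (S : comNzRingType) (P : 'M[S]_(k, n)).

(* The second block, the form at u0, normalizes the constant solutions away. *)
Definition discrepancy (a : 'M[S]_(n, k)) : 'M[S]_(n, n + k) :=
  row_mx (\matrix_(u, v) if v \in E u then (a *m P) u v - (a *m P) v v else 0)
         (\matrix_(u, j) if u == u0 then a u j else 0).

Fact discrepancy_is_linear : linear discrepancy.
Proof.
move=> c a b; rewrite /discrepancy scale_row_mx add_row_mx.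
congr row_mx; apply/matrixP => u v; rewrite !mxE; case: ifP => _; rewrite ?mulr0 ?addr0//.
have E1 w : \sum_j (c *: a + b) w j * P j v =
  c * (\sum_j a w j * P j v) + \sum_j b w j * P j v.
  by rewrite mulr_sumr -big_split; apply: eq_bigr => j _; rewrite !mxE mulrDl mulrA.
by rewrite !E1 mulrBr opprD addrACA.
Qed.
HB.instance Definition _ := GRing.isLinear.Build S 'M[S]_(n, k) 'M[S]_(n, n + k) _
  discrepancy discrepancy_is_linear.

Definition discrepancy_mx := lin_mx discrepancy.
End Discrepancy.

Lemma map_discrepancy_mx (S S' : comNzRingType) (f : {rmorphism S -> S'})
    (P : 'M[S]_(k, n)) :
  map_mx f (discrepancy_mx P) = discrepancy_mx (map_mx f P).
Proof.
apply/matrixP => i j; rewrite !mxE /=.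
rewrite -[delta_mx 0 i in RHS](map_delta_mx f) -map_vec_mx.
set a := vec_mx _; case/mxvec_indexP: j => u v; rewrite !mxvecE.
have [w ->|w ->] := split_ordP v.
  rewrite !row_mxEl [in LHS]mxE [in RHS]mxE -map_mxM.
  by case: ifP => _; rewrite ?rmorph0// rmorphB !mxE.
by rewrite !row_mxEr !mxE; case: ifP; rewrite ?rmorph0.
Qed.

Lemma affinely_rigidP (F : numFieldType) (P : 'M[F]_(k, n)) :
  reflect (affinely_rigid E P) (row_free (discrepancy_mx P)).
Proof.
apply: (iffP idP) => [freeC a aP|rigP].
  (* Subtracting this constant family makes both blocks of the discrepancy vanish. *)
  pose c := \matrix_(u < n) row u0 a.
  have cP u v : (c *m P) u v = (c *m P) v v.
    by rewrite !mxE; apply: eq_bigr => j _; rewrite !mxE.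
  have acP u v : ((a - c) *m P) u v = (a *m P) u v - (c *m P) u v.
    by rewrite mulmxBl !mxE.
  suff ac : a - c = 0 by move=> u v; rewrite -(subrK c a) ac add0r !rowK.
  apply/eqP; rewrite -mxvec_eq0; apply/eqP/(row_free_inj freeC).
  suff d0 : discrepancy P (a - c) = 0 by rewrite mul0mx mul_vec_lin /= d0 linear0.
  apply/matrixP => u v; rewrite [RHS]mxE.
  have [w ->|w ->] := split_ordP v; rewrite ?row_mxEl ?row_mxEr mxE; case: ifP => //.
    by move=> uw; rewrite !acP (aP _ _ uw) (cP u) subrr.
  by move=> /eqP ->; rewrite !mxE subrr.
rewrite -kermx_eq0; apply/eqP/row_matrixP => i; rewrite row0.
set x := row i _; have : x *m discrepancy_mx P = 0 by rewrite -row_mul mulmx_ker row0.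
rewrite mul_rV_lin => /eqP; rewrite mxvec_eq0 => /eqP dx.
rewrite -[x]vec_mxK; set a := vec_mx x in dx *.
suff -> : a = 0 by rewrite linear0.
have rowa : forall u v, row u a = row v a.
  apply: rigP => u v uv; apply/eqP; rewrite -subr_eq0; apply/eqP.
  by move/matrixP: dx => /(_ u (lshift k v)); rewrite row_mxEl !mxE uv.
apply/row_matrixP => u; rewrite (rowa u u0) row0; apply/rowP => j.
by move/matrixP: dx => /(_ u0 (rshift n j)); rewrite row_mxEr !mxE eqxx.
Qed.

(** Full row rank at [x0] gives a rational right inverse [D] there. The determinant of the symbolic
    matrix times [D] is 1 at [x0], and wherever it is nonzero the row rank is full. *)
Lemma affinely_rigid_transfer N (P : 'M[{mpoly rat[N]}]_(k, n)) (x0 : 'I_N -> rat) :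
    affinely_rigid E (map_mx (meval x0) P) ->
  exists2 Q : {mpoly rat[N]}, Q != 0 &
    forall (F : numFieldType) (x : 'I_N -> F),
      meval x (map_mpoly ratr Q) != 0 ->
      affinely_rigid E (map_mx (meval x \o map_mpoly ratr) P).
Proof.
move/affinely_rigidP => freeP0; pose D := pinvmx (discrepancy_mx (map_mx (meval x0) P)).
pose Q := \det (discrepancy_mx P *m map_mx (@mpolyC N rat) D); exists Q.
  have Q1 : meval x0 Q = 1.
    rewrite -det_map_mx map_mxM map_discrepancy_mx -map_mx_comp.
    rewrite (_ : map_mx _ D = D); last by apply/matrixP => i j; rewrite mxE /= mevalC.
    by rewrite mulmxVp// det1.
  by apply: contraTneq (oner_neq0 rat) => Q0; rewrite -Q1 Q0 meval0 eqxx.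
move=> F x Qx; apply/affinely_rigidP.
rewrite -(map_discrepancy_mx (meval x \o map_mpoly ratr)).
have : map_mx (meval x \o map_mpoly ratr)
    (discrepancy_mx P *m map_mx (@mpolyC N rat) D) \in unitmx.
  by rewrite unitmxE det_map_mx unitfE.
rewrite map_mxM -row_free_unit /row_free => /eqP rk.
rewrite eqn_leq rank_leq_row -{1}rk; exact: mxrankM_maxl.
Qed.
End Transfer.

(** * Affine equivalences as families of linear forms *)

Theorem theorem5p1 (R : realType) (d : nat) (V : finType) (e : rel V) :
  (1 <= d)%N -> simple_graph e -> (d.+1 <= #|V|)%N ->
  k_vertex_connected e d.+1 ->
  forall p : V -> 'rV[R]_d, generic p -> aff_rigid (nbhd_hypergraph e) p.
Proof.
move=> _ _ lt_dV conn p gen_p q eqv_pq.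
have [p0 rig_p0] := exists_affine_rigid rat lt_dV (cnbhd_expanding conn).
pose u0 : 'I_#|V| := Ordinal (leq_trans (ltn0Sn d) lt_dV).
pose hat (S : nzRingType) (x : 'I_(#|V| * d) -> S) : 'M[S]_(1 + d, #|V|) :=
  col_mx (const_mx 1) (\matrix_(j, v) x (mxvec_index v j)).
have hat_map (S S' : nzRingType) (f : {rmorphism S -> S'}) x :
    map_mx f (hat S x) = hat S' (f \o x).
  rewrite map_col_mx map_const_mx rmorph1; congr col_mx.
  by apply/matrixP => j v; rewrite !mxE.
have [|Q Q_neq0 rigQ] := @affinely_rigid_transfer _ _ (cnbhd e) u0 _
    (hat _ (fun i => 'X_i)) (fun i => mxvec p0^T 0 i).
  rewrite hat_map (_ : hat _ _ = col_mx (const_mx 1) p0)//; congr col_mx.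
  by apply/matrixP => j v; rewrite !mxE /= mevalXU mxvecE mxE.
have rig_p : affinely_rigid (cnbhd e) (hat R (coords p)).
  have := rigQ _ _ (gen_p Q Q_neq0); rewrite hat_map; congr affinely_rigid; congr col_mx.
  by apply/matrixP => j v; rewrite !mxE /= map_mpolyX mevalXU.
have AP u : exists (A : 'M[R]_d) (b : 'rV[R]_d), A \in unitmx /\
    forall v, v \in cnbhd e u -> q (enum_val v) = p (enum_val v) *m A + b.
  have [|A [b [AU qE]]] := eqv_pq (enum_val u |: [set v | e (enum_val u) v]).
    by apply/imsetP; exists (enum_val u).
  exists A, b; split=> // v; rewrite inE => uv; apply: qE.
  by rewrite !inE (inj_eq enum_val_inj).
have [A {}AP] := fin_all_exists AP; have [b bP] := fin_all_exists AP.
exists (A u0), (b u0); split=> [|x]; first by have [] := bP u0.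
(* The [j]-th coordinate of the affine map at [u], as a linear form in homogeneous coordinates; near
   [u] its values are those of [q]. *)
pose a j : 'M_(#|V|, 1 + d) := \matrix_u row_mx (const_mx (b u 0 j)) (col j (A u))^T.
have aE j u v : v \in cnbhd e u ->
    (a j *m hat R (coords p)) u v = q (enum_val v) 0 j.
  move=> uv; have [_ /(_ v uv) ->] := bP u.
  transitivity (row u (a j *m hat R (coords p)) 0 v); first by rewrite [RHS]mxE.
  rewrite row_mul rowK mul_row_col mxE [RHS]mxE addrC; congr (_ + _).
    rewrite !mxE; apply: eq_bigr => i _.
    by rewrite !mxE /coords mxvecE mxE mulrC.
  by rewrite mxE big_ord1 !mxE mulr1.
have rig_a j : forall u v, row u (a j) = row v (a j).
  by apply: rig_p => u v uv; rewrite !aE// cnbhd_refl.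
have Au u : A u = A u0.
  apply/matrixP => i j; have := rig_a j u u0; rewrite !rowK => /eq_row_mx[_].
  by move/trmx_inj/colP/(_ i); rewrite !mxE.
have bu u : b u = b u0.
  apply/rowP => j; have := rig_a j u u0; rewrite !rowK => /eq_row_mx[+ _].
  by move/rowP/(_ 0); rewrite !mxE.
have [_ /(_ _ (cnbhd_refl e (enum_rank x)))] := bP (enum_rank x).
by rewrite enum_rankK Au bu.
Qed.
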